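(* Let $K$ be a complete discrete valuation field, $n \ge 1$, and let $M \in M_n(K)$ be a matrix having a cyclic vector, with characteristic polynomial $\chi_M = a_0 + a_1 X + \cdots + a_{n-1}X^{n-1} + X^n$. Let $\mathscr{C}$ be the companion matrix $$\mathscr{C} = \begin{pmatrix} 0 & 1 & 0 & \cdots & 0 \\ 0 & 0 & 1 & \ddots & \vdots \\ \vdots & \vdots & \ddots & \ddots & 0 \\ 0 & 0 & \cdots & 0 & 1 \\ -a_0 & -a_1 & \cdots & \cdots & -a_{n-1}\end{pmatrix}$$ and let $P, Q \in \mathrm{GL}_n(K)$ be such that $M = P\mathscr{C}P^{-1}$ and $M^t = Q\mathscr{C}Q^{-1}$. Let $V$ be the row vector $(1, X, \ldots, X^{n-1})$. Then there exists $\alpha \in K[X]$ such that $$\mathrm{Com}(X - M) \equiv \alpha \cdot P V^t \cdot V Q^t \pmod{\chi_M}.$$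
   Context: Here $A^t$ denotes the transpose of $A$; $X - M$ means $X I_n - M \in M_n(K[X])$; $\mathrm{Com}(A)$ is the comatrix of a square matrix $A$, normalized so that $A\cdot\mathrm{Com}(A) = \mathrm{Com}(A)\cdot A = \det(A) I_n$ (i.e. the adjugate of $A$; $\mathrm{Com}(A) = \det(A)A^{-1}$ when $A$ is invertible). The characteristic polynomial is $\chi_M = \det(X-M)$. The congruence of matrices over $K[X]$ modulo $\chi_M$ is entrywise. A cyclic vector for $M$ is a $c \in K^n$ such that $c, Mc, \ldots, M^{n-1}c$ is a basis of $K^n$; when $M$ has one, $M$ and $M^t$ are both similar to $\mathscr{C}$, so that matrices $P, Q$ as in the claim exist. *)

(* Defs.v *)
From HB Require Import structures.
From mathcomp Require Import all_boot all_order all_algebra.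
From mathcomp Require Import constructive_ereal.

Set Implicit Arguments.
Unset Strict Implicit.
Unset Printing Implicit Defensive.

Import Order.TTheory GRing.Theory Num.Theory.

Local Open Scope ring_scope.

(* [v] is a normalized discrete valuation K ->> Z + {+oo} for which K is
   complete.  The type [\bar int] also has an element -oo, which is excluded. *)
Record complete_discrete_valuation (K : fieldType) (v : K -> \bar int) :
    Prop := CompleteDiscreteValuation {
  cdv_neqNy : forall x, v x <> -oo%E;
  cdv_eqy : forall x, v x = +oo%E <-> x = 0;
  cdvM : forall x y, v (x * y) = (v x + v y)%E;
  cdvD : forall x y, (Order.min (v x) (v y) <= v (x + y)%R)%E;
  cdv_surj : forall m : int, exists x, v x = m%:E%E;
  cdv_complete : forall u : nat -> K,
    (forall m : int, exists N : nat, forall i j : nat,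
       (N <= i)%N -> (N <= j)%N -> (m%:E <= v (u i - u j)%R)%E) ->
    exists l : K, forall m : int, exists N : nat, forall i : nat,
      (N <= i)%N -> (m%:E <= v (u i - l)%R)%E
}.

Definition cyclic_vector (K : fieldType) (n : nat) (M : 'M[K]_n)
    (c : 'cV[K]_n) : bool :=
  basis_of fullv [seq M ^+ i *m c | i <- iota 0 n].

Lemma size_char_poly_pred (K : fieldType) (n : nat) (M : 'M[K]_n) :
  (size (char_poly M)).-1 = n.
Proof. by rewrite size_char_poly. Qed.

(* [companionmx p] has dimension [(size p).-1], which for [p = char_poly M] is
   only provably equal to [n]; hence the cast. *)
Definition char_companionmx (K : fieldType) (n : nat) (M : 'M[K]_n) : 'M[K]_n :=
  castmx (size_char_poly_pred M, size_char_poly_pred M)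
    (companionmx (char_poly M)).

Lemma char_companionmxE (K : fieldType) (n : nat) (M : 'M[K]_n) (i j : 'I_n) :
  char_companionmx M i j =
  if i == n.-1 :> nat then - (char_poly M)`_j else (i.+1 == j)%:R.
Proof. by rewrite castmxE mxE /= size_char_poly_pred. Qed.

Definition powers_row (K : fieldType) (n : nat) : 'rV[{poly K}]_n :=
  \row_(j < n) 'X^j.

Definition eqmx_modp (K : fieldType) (m n : nat) (p : {poly K})
    (A B : 'M[{poly K}]_(m, n)) : Prop :=
  forall i j, p %| A i j - B i j.

(* Main.v *)
Require Import Defs.
From HB Require Import structures.
From mathcomp Require Import all_boot all_order all_algebra.
From mathcomp Require Import constructive_ereal ring.

(** Write the adjugate of [X - M] as [Com(X - M) = P D Q^T].  Both
    [(X - M) Com(X - M)] and [Com(X - M) (X - M)] are [chi_M] times the identity,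
    so modulo [chi_M] the columns of [D], and the columns of its transpose, are
    killed by [X - C], where [C] is the companion matrix.  All rows of [C] but
    the last one are shifts: a vector [w] with [(X - C) w = 0] satisfies
    [w_(i+1) = X w_i], hence is [w_0] times the column of powers of [X]
    ([companion_kernel_powers]).  Using this in both indices,
    [D_(i,j) = X^(i+j) D_(0,0)] modulo [chi_M], which says that [D] is
    [D_(0,0) V^T V]; so [alpha = D_(0,0)]. *)

Set Implicit Arguments.
Unset Strict Implicit.
Unset Printing Implicit Defensive.

Import Order.TTheory GRing.Theory Num.Theory.

Local Open Scope ring_scope.

Lemma dvdp_bigsum (K : fieldType) (I : finType) (p : {poly K})
    (F : I -> {poly K}) :
  (forall i, p %| F i) -> p %| \sum_i F i.
Proof.
by move=> hF; apply: (big_ind (fun q => p %| q)) => // *;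
  rewrite ?dvdp0 ?dvdp_add.
Qed.

Lemma eqmx_modp_mul (K : fieldType) (p : {poly K}) (m1 m2 m3 m4 : nat)
    (L : 'M_(m1, m2)) (A B : 'M_(m2, m3)) (R : 'M_(m3, m4)) :
  eqmx_modp p A B -> eqmx_modp p (L *m A *m R) (L *m B *m R).
Proof.
move=> hAB i j.
have -> : (L *m A *m R) i j - (L *m B *m R) i j = (L *m (A - B) *m R) i j.
  by rewrite mulmxBr mulmxBl !mxE.
rewrite mxE; apply: dvdp_bigsum => k; apply: dvdp_mulr.
rewrite mxE; apply: dvdp_bigsum => l; apply: dvdp_mull.
by have := hAB l k; rewrite !mxE.
Qed.

Lemma char_poly_mx_tr (K : fieldType) (n : nat) (M : 'M[K]_n) :
  char_poly_mx M^T = (char_poly_mx M)^T.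
Proof. by rewrite /char_poly_mx linearB /= tr_scalar_mx map_trmx. Qed.

Lemma char_poly_mx_intertwine (K : fieldType) (n : nat) (M C P : 'M[K]_n) :
  M *m P = P *m C ->
  char_poly_mx M *m map_mx polyC P = map_mx polyC P *m char_poly_mx C.
Proof.
move=> h; rewrite /char_poly_mx mulmxBl mulmxBr -!map_mxM h.
by rewrite scalar_mxC.
Qed.

(** Since [j = i.+1] exists, [i] is not the last index, so row [i] of the
    companion matrix is the basis vector of index [j]. *)
Lemma companion_row_mul (K : fieldType) (n m : nat) (M : 'M[K]_n)
    (D : 'M[{poly K}]_(n, m)) (i j : 'I_n) (k : 'I_m) :
  j = i.+1 :> nat ->
  (char_poly_mx (char_companionmx M) *m D) i k = 'X * D i k - D j k.
Proof.
move=> hj; rewrite /char_poly_mx mulmxBl mul_scalar_mx !mxE; congr (_ - _).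
have hi : (i == n.-1 :> nat) = false.
  by apply/negbTE; rewrite neq_ltn -subn1 ltn_subRL add1n -hj ltn_ord.
rewrite (bigD1 j) //= mxE char_companionmxE hi hj eqxx mul1r big1 ?addr0 // => l hl.
rewrite mxE char_companionmxE hi -hj.
have -> : (j == l :> nat) = false by apply: contraNF hl => /eqP/val_inj ->.
by rewrite mul0r.
Qed.

(** Modulo [p], the kernel of [X - C] lies in the span of the vector of
    powers of [X]: the recursion [w_(i+1) = X w_i] determines a kernel vector from its
    first entry. *)
Lemma companion_kernel_powers (K : fieldType) (n m : nat) (p : {poly K})
    (M : 'M[K]_n.+1) (D : 'M[{poly K}]_(n.+1, m)) (i : 'I_n.+1) (k : 'I_m) :
  eqmx_modp p (char_poly_mx (char_companionmx M) *m D) 0 ->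
  p %| D i k - 'X^i * D ord0 k.
Proof.
move=> hD; case: i; elim=> [|i IHi] hi /=.
  rewrite expr0 mul1r (_ : Ordinal hi = ord0) ?subrr ?dvdp0 //; exact: val_inj.
have hi' := ltnW hi; have := hD (Ordinal hi') k.
rewrite (@companion_row_mul _ _ _ _ _ _ (Ordinal hi)) // mxE subr0 => hstep.
have -> : D (Ordinal hi) k - 'X^(i.+1) * D ord0 k =
    'X * (D (Ordinal hi') k - 'X^i * D ord0 k)
    - ('X * D (Ordinal hi') k - D (Ordinal hi) k).
  by rewrite exprS; ring.
by rewrite dvdp_sub // dvdp_mull // IHi.
Qed.

(** The first hypothesis reduces each column of [D] to its top entry, and the
    second one reduces the top row to [D_(0,0)]; the two powers of [X] picked
    up on the way are the entries of [V^T V]. *)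
Lemma companion_bikernel_powers (K : fieldType) (n : nat) (p : {poly K})
    (M : 'M[K]_n.+1) (D : 'M[{poly K}]_n.+1) :
  eqmx_modp p (char_poly_mx (char_companionmx M) *m D) 0 ->
  eqmx_modp p (char_poly_mx (char_companionmx M) *m D^T) 0 ->
  eqmx_modp p D
    (D ord0 ord0 *: ((powers_row K n.+1)^T *m powers_row K n.+1)).
Proof.
move=> hD hDt i j.
have h1 := companion_kernel_powers i j hD.
have := companion_kernel_powers j ord0 hDt; rewrite !mxE => h2.
rewrite big_ord1 !mxE.
have -> : D i j - D ord0 ord0 * ('X^i * 'X^j) =
    (D i j - 'X^i * D ord0 j) + 'X^i * (D ord0 j - 'X^j * D ord0 ord0).
  by ring.
by rewrite dvdp_add // dvdp_mull.
Qed.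

(** [X - C] passes through [P^-1] to become [X - M], which meets its adjugate
    and leaves [chi_M].  Used with [M] and with [M^T], where [R] is the change
    of basis coming from the other one. *)
Lemma char_companion_mul_adj (K : fieldType) (n : nat) (M C P : 'M[K]_n)
    (R : 'M[{poly K}]_n) :
  P \in unitmx -> M = P *m C *m invmx P ->
  eqmx_modp (char_poly M)
    (char_poly_mx C *m
       (map_mx polyC (invmx P) *m \adj (char_poly_mx M) *m R)) 0.
Proof.
move=> hP hM.
have hMP : invmx P *m M = C *m invmx P by rewrite {1}hM !mulmxA mulVmx ?mul1mx.
have hconj : char_poly_mx C *m map_mx polyC (invmx P) =
    map_mx polyC (invmx P) *m char_poly_mx M.
  exact/char_poly_mx_intertwine/esym.
rewrite !mulmxA hconj -(mulmxA _ (char_poly_mx M)) mul_mx_adj mul_mx_scalar.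
by move=> i j; rewrite -scalemxAl !mxE subr0 dvdp_mulr.
Qed.

Theorem proposition2p7 (K : fieldType) (v : K -> \bar int)
    (hv : complete_discrete_valuation v)
    (n : nat) (hn : (1 <= n)%N) (M : 'M[K]_n)
    (hM : exists c : 'cV[K]_n, cyclic_vector M c)
    (P Q : 'M[K]_n) (hP : P \in unitmx) (hQ : Q \in unitmx)
    (hMP : M = P *m char_companionmx M *m invmx P)
    (hMQ : M^T = Q *m char_companionmx M *m invmx Q) :
  let V : 'rV[{poly K}]_n := powers_row K n in
  exists alpha : {poly K},
    eqmx_modp (char_poly M) (\adj (char_poly_mx M))
      (alpha *: ((map_mx polyC P *m V^T) *m (V *m (map_mx polyC Q)^T))).
Proof.
move=> V; rewrite {}/V.
case: n hn M hM P Q hP hQ hMP hMQ => // n _ M _ P Q hP hQ hMP hMQ.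
(* [D] is the adjugate read in the bases given by [P] and [Q]. *)
pose D := map_mx polyC (invmx P) *m \adj (char_poly_mx M)
          *m (map_mx polyC (invmx Q))^T.
have map_mulV (A : 'M[K]_n.+1) : A \in unitmx ->
    map_mx polyC A *m map_mx polyC (invmx A) = 1%:M.
  by move=> hA; rewrite -map_mxM mulmxV // map_mx1.
have hDt : D^T = map_mx polyC (invmx Q) *m \adj (char_poly_mx M^T)
    *m (map_mx polyC (invmx P))^T.
  by rewrite !trmx_mul trmxK trmx_adj -char_poly_mx_tr mulmxA.
have hchi : char_poly M^T = char_poly M.
  by rewrite /char_poly char_poly_mx_tr det_tr.
have hadj : \adj (char_poly_mx M) =
    map_mx polyC P *m D *m (map_mx polyC Q)^T.
  rewrite !mulmxA map_mulV // mul1mx -mulmxA -trmx_mul map_mulV //.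
  by rewrite trmx1 mulmx1.
exists (D ord0 ord0).
rewrite [X in eqmx_modp _ X _]hadj.
have -> : D ord0 ord0 *: (map_mx polyC P *m (powers_row K n.+1)^T
      *m (powers_row K n.+1 *m (map_mx polyC Q)^T)) =
    map_mx polyC P *m
      (D ord0 ord0 *: ((powers_row K n.+1)^T *m powers_row K n.+1))
    *m (map_mx polyC Q)^T.
  by rewrite -scalemxAr -scalemxAl !mulmxA.
apply/eqmx_modp_mul/companion_bikernel_powers.
  exact (char_companion_mul_adj _ hP hMP).
by rewrite hDt -hchi; exact: (char_companion_mul_adj _ hQ hMQ).
Qed.
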